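(* For every $n\ge 1$, the Catalan inversion sequences of length $n$ are in bijection with $AV_n(1\text{-}23,\,2\text{-}14\text{-}3)$. Consequently, the family $AV(1\text{-}23,\,2\text{-}14\text{-}3)$ is enumerated by the Catalan numbers, i.e. $|AV_n(1\text{-}23,\,2\text{-}14\text{-}3)|=\frac{1}{n+1}\binom{2n}{n}$ for every $n\ge1$.
   Context: An inversion sequence of length $n$ is an integer sequence $e=(e_1,\ldots,e_n)$ with $0\le e_i<i$ for all $i$. A Catalan inversion sequence is an element of $\mathbf{I}(\geq,-,\geq)$, i.e. an inversion sequence with no three indices $i<j<k$ such that $e_i\ge e_j$ and $e_i\ge e_k$. A vincular pattern is a permutation in which two adjacent entries may or may not be separated by a dash; a permutation $\pi$ contains it if $\pi$ has a subsequence order-isomorphic to the pattern in which entries corresponding to pattern entries not separated by a dash are consecutive entries of $\pi$; otherwise $\pi$ avoids it. Thus $\pi=\pi_1\cdots\pi_n$ contains $1\text{-}23$ if there are indices $i<j$ with $j+1\le n$ and $\pi_i<\pi_j<\pi_{j+1}$; it contains $2\text{-}14\text{-}3$ if there are indices $i<j$ and $k>j+1$ with $\pi_j<\pi_i<\pi_k<\pi_{j+1}$. For a set $\mathcal{T}$ of patterns, $AV_n(\mathcal{T})$ is the set of permutations of $\{1,\ldots,n\}$ avoiding every pattern in $\mathcal{T}$, and $AV(\mathcal{T})=\bigcup_n AV_n(\mathcal{T})$. *)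

(* Defs.v *)
From mathcomp Require Import all_boot all_fingroup.

Set Implicit Arguments.
Unset Strict Implicit.
Unset Printing Implicit Defensive.

Local Open Scope nat_scope.

(* Positions are counted from 0, so that the condition 0 <= e_i < i on the i-th
   entry becomes e i : 'I_i.+1. *)
Definition inversion_seq (n : nat) := {dffun forall i : 'I_n, 'I_i.+1}.

(* I(r1, r2, r3): no i < j < k with e_i r1 e_j, e_j r2 e_k and e_i r3 e_k. *)
Definition inv_avoid (r1 r2 r3 : rel nat) (n : nat) : {set inversion_seq n} :=
  [set e : inversion_seq n |
    ~~ [exists i : 'I_n, exists j : 'I_n, exists k : 'I_n,
          [&& i < j, j < k, r1 (e i) (e j), r2 (e j) (e k) & r3 (e i) (e k)]]].

Definition any_rel : rel nat := fun _ _ => true.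

Definition catalan_inversion_seqs (n : nat) : {set inversion_seq n} :=
  inv_avoid geq any_rel geq n.

(* A vincular pattern is given by its dash-separated blocks; for instance
   2-14-3 is [:: [:: 2]; [:: 1; 4]; [:: 3]]. *)
Definition vincular_axiom (b : seq (seq nat)) : bool :=
  ([::] \notin b) && perm_eq (flatten b) (iota 1 (size (flatten b))).

Record vincular := Vincular {
  vblocks : seq (seq nat);
  vblocksP : vincular_axiom vblocks
}.

Definition vword (p : vincular) : seq nat := flatten (vblocks p).

Definition vsize (p : vincular) : nat := size (vword p).

Definition same_block (p : vincular) (a b : nat) : bool :=
  reshape_index (shape (vblocks p)) a == reshape_index (shape (vblocks p)) b.

(* Permutations of {1, ..., n} are represented by 'S_n, that is, with positions
   and values both shifted down by 1. *)
Definition occurrence (n : nat) (p : vincular) (pi : 'S_n)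
    (g : {ffun 'I_(vsize p) -> 'I_n}) : bool :=
  [&& [forall a : 'I_(vsize p), forall b : 'I_(vsize p),
         (a < b) ==> (g a < g b)],
      [forall a : 'I_(vsize p), forall b : 'I_(vsize p),
         (pi (g a) < pi (g b)) == (nth 0 (vword p) a < nth 0 (vword p) b)]
    & [forall a : 'I_(vsize p), forall b : 'I_(vsize p),
         ((b == a.+1 :> nat) && same_block p a b) ==> (g b == (g a).+1 :> nat)]].

Definition contains (n : nat) (pi : 'S_n) (p : vincular) : bool :=
  [exists g : {ffun 'I_(vsize p) -> 'I_n}, occurrence pi g].

Definition AV (n : nat) (T : seq vincular) : {set 'S_n} :=
  [set pi : 'S_n | all (fun p => ~~ contains pi p) T].

Definition pat_1_23 : vincular :=
  @Vincular [:: [:: 1]; [:: 2; 3]] isT.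

Definition pat_2_14_3 : vincular :=
  @Vincular [:: [:: 2]; [:: 1; 4]; [:: 3]] isT.

Lemma contains_1_23P (n : nat) (pi : 'S_n) :
  reflect (exists i j j' : 'I_n,
             [/\ i < j, j' = j.+1 :> nat, pi i < pi j & pi j < pi j'])
          (contains pi pat_1_23).
Proof.
apply: (iffP existsP) => [[g /and3P[/forallP inc /forallP iso /forallP adj]]|].
  pose o k (lt : k < 3) : 'I_(vsize pat_1_23) := Ordinal lt.
  pose a := @o 0 isT; pose b := @o 1 isT; pose c := @o 2 isT.
  exists (g a), (g b), (g c); split.
  - by have /forallP/(_ b)/implyP-> := inc a.
  - by have /forallP/(_ c)/implyP/(_ isT)/eqP-> := adj b.
  - by have /forallP/(_ b)/eqP-> := iso a.
  - by have /forallP/(_ c)/eqP-> := iso b.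
move=> [i [j [j' [ij Ej' pij pjj']]]].
have jj' : j < j' by rewrite Ej'.
have pij' := ltn_trans pij pjj'.
exists [ffun k : 'I_(vsize pat_1_23) => nth i [:: i; j; j'] k].
apply/and3P; split; apply/forallP => -[[|[|[|//]]] lta];
  apply/forallP => -[[|[|[|//]]] ltb]; rewrite !ffunE //= ?ltnn //.
all: by rewrite ?(ltn_trans ij jj') ?pij ?pjj' ?pij' ?(leq_gtF (ltnW pij))
           ?(leq_gtF (ltnW pjj')) ?(leq_gtF (ltnW pij')) ?Ej'.
Qed.

Lemma contains_2_14_3P (n : nat) (pi : 'S_n) :
  reflect (exists i j j' k : 'I_n,
             [/\ [/\ i < j, j' = j.+1 :> nat & j' < k],
                 pi j < pi i, pi i < pi k & pi k < pi j'])
          (contains pi pat_2_14_3).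
Proof.
apply: (iffP existsP) => [[g /and3P[/forallP inc /forallP iso /forallP adj]]|].
  pose o k (lt : k < 4) : 'I_(vsize pat_2_14_3) := Ordinal lt.
  pose a := @o 0 isT; pose b := @o 1 isT; pose c := @o 2 isT.
  pose d := @o 3 isT.
  exists (g a), (g b), (g c), (g d); split; first split.
  - by have /forallP/(_ b)/implyP-> := inc a.
  - by have /forallP/(_ c)/implyP/(_ isT)/eqP-> := adj b.
  - by have /forallP/(_ d)/implyP-> := inc c.
  - by have /forallP/(_ a)/eqP-> := iso b.
  - by have /forallP/(_ d)/eqP-> := iso a.
  - by have /forallP/(_ c)/eqP-> := iso d.
move=> [i [j [j' [k [[ij Ej' j'k] pji pik pkj']]]]].
have jj' : j < j' by rewrite Ej'.
have ij' := ltn_trans ij jj'; have jk := ltn_trans jj' j'k.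
have ik := ltn_trans ij jk.
have pjk := ltn_trans pji pik; have pij' := ltn_trans pik pkj'.
have pjj' := ltn_trans pji pij'.
exists [ffun l : 'I_(vsize pat_2_14_3) => nth i [:: i; j; j'; k] l].
apply/and3P; split; apply/forallP => -[[|[|[|[|//]]]] lta];
  apply/forallP => -[[|[|[|[|//]]]] ltb]; rewrite !ffunE //= ?ltnn //.
all: by rewrite ?ij' ?jk ?ik ?pji ?pik ?pkj' ?pjk ?pij' ?pjj'
           ?(leq_gtF (ltnW pji)) ?(leq_gtF (ltnW pik)) ?(leq_gtF (ltnW pkj'))
           ?(leq_gtF (ltnW pjk)) ?(leq_gtF (ltnW pij')) ?(leq_gtF (ltnW pjj'))
           ?Ej'.
Qed.

(* Main.v *)
Require Import Defs.
From mathcomp Require Import all_boot all_fingroup all_algebra.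
From mathcomp Require Import zify.

Set Implicit Arguments.
Unset Strict Implicit.
Unset Printing Implicit Defensive.

(** Each of the two families is grown one step at a time along a generating tree
    whose labels record just enough to know the possible next steps; counting
    the nodes of both trees gives the Catalan number in either case, and finite
    sets of equal size are in bijection.

    Permutations are grown by inserting a new maximum. After position d it
    creates an ascent with top n, and the two patterns are avoided exactly when
    all entries before d exceed all entries from d on, i.e. when a component of
    the skew decomposition starts at d ([ins_maxS_AV]); the front is always
    allowed ([ins_max0_AV]). A permutation with k components thus has k+1
    children. Inserting at the front adds a component, while inserting inside
    merges the components up to the insertion, so the children have
    1, 2, ..., k+1 components ([catalan_perms_succ]): the classical Catalan
    rule.

    Inversion sequences are grown by appending an entry. The condition says that
    every entry has at most one later entry that does not exceed it. So a new
    entry must exceed all entries that already have such a successor, and it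
    suffices to remember the largest of these and the overall maximum. This
    gives a rule with two labels ([catalan_inv_succ]).

    With C = 1 + x C^2 the Catalan generating function, the node counts of the
    two trees are [ballot] numbers, the coefficients of the powers of C:
    C^(k+1) under the label (k) ([nodes_one_label]), and
    1 + x (C^2 + C^4 + ... + C^(2p)) + q x C^(2p+1) under (p, q)
    ([nodes_two_label]). Both are C at the root. *)

(** * Ballot numbers *)

(** This is the coefficient of x^m in C(x)^k, where C = 1 + x C^2 is the
    generating function of the Catalan numbers: iterating
    C^k = C^(k-1) + x C^(k+1) down to k = 0 gives the sum below. *)
Fixpoint ballot (m k : nat) : nat :=
  if m is m'.+1 then \sum_(j < k) ballot m' j.+2 else 1.

Lemma ballotSS m k : ballot m.+1 k.+1 = ballot m.+1 k + ballot m k.+2.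
Proof. by rewrite /= big_ord_recr. Qed.

(** The reflection-principle difference, with the subtracted term moved to the
    other side to avoid truncated subtraction. Shifting the first argument to
    m.+1 avoids the binomial coefficient with index m - 1. *)
Lemma ballot_bin m k :
  ballot m.+1 k + 'C(m.*2.+1 + k, m) = 'C(m.*2.+1 + k, m.+1).
Proof.
elim: m k => [|m IHm]; elim=> [|k IHk].
- by rewrite /= big_ord0.
- by move: IHk; rewrite ballotSS !bin0 !bin1 [ballot 0 _]/=; lia.
- rewrite /= big_ord0 add0n addn0 -[RHS]bin_sub; last by lia.
  by congr 'C(_, _); lia.
have := IHm k.+2; have -> : m.*2.+1 + k.+2 = m.+1.*2.+1 + k by lia.
rewrite (ballotSS m.+1) [_ + k.+1]addnS.
move: IHk; set N := _ + k.
by rewrite ['C(N.+1, m.+1)]binS ['C(N.+1, m.+2)]binS; lia.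
Qed.

(** The previous lemma gives 'C(2n, n) - 'C(2n, n-1), and the ratio of these two
    neighbours is (n+1) / n. *)
Lemma ballot1_catalan n : n.+1 * ballot n 1 = 'C(2 * n, n).
Proof.
case: n => [//|n]; have := ballot_bin n 1.
rewrite mul2n addn1 -doubleS; set B := 'C(_, n.+1); set A := 'C(_, n) => e.
have := mul_bin_left (n.+1).*2 n; rewrite -/A -/B => h.
by nia.
Qed.

(** * Counting nodes in generating trees *)

Section GeneratingTree.
Variables (L : Type) (succ : L -> seq L).

(** The number of nodes [m] levels below a node labelled [l] in the tree where
    the children of a node labelled [l] carry the labels listed in [succ l]. *)
Fixpoint nodes (m : nat) (l : L) : nat :=
  if m is m'.+1 then \sum_(l' <- succ l) nodes m' l' else 1.

(** The growth of a family is only required to match the tree after summing an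
    arbitrary weight of the labels; no parent map has to be exhibited. The
    induction works because the number of nodes [m] levels below is itself such
    a weight. *)
Lemma card_generating_tree (X : nat -> finType) (A : forall n, {set X n})
    (lab : forall n, X n -> L) (root : L) :
  (forall F : L -> nat, \sum_(x in A 0) F (lab 0 x) = F root) ->
  (forall n (F : L -> nat), \sum_(y in A n.+1) F (lab n.+1 y) =
     \sum_(x in A n) \sum_(l <- succ (lab n x)) F l) ->
  forall n, #|A n| = nodes n root.
Proof.
move=> A0 AS n.
suff nodesA m : \sum_(x in A n) nodes m (lab n x) = nodes (n + m) root.
  by rewrite -[n in nodes n]addn0 -nodesA -sum1_card.
elim: n m => [|n IHn] m; first exact: A0.
by rewrite AS (IHn m.+1) addnS.
Qed.

End GeneratingTree.

Lemma sum_iota1 k (F : nat -> nat) :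
  \sum_(l <- iota 1 k) F l = \sum_(j < k) F j.+1.
Proof.
rewrite (iotaDl 1 0) big_map -[in LHS](subn0 k) -/(index_iota 0 k).
exact: big_mkord.
Qed.

(** The classical Catalan rule (k) -> (1)(2)...(k+1). *)
Lemma nodes_one_label m k :
  nodes (fun k => iota 1 k.+1) m k = ballot m k.+1.
Proof.
elim: m k => [//|m IHm] k.
rewrite -[LHS]/(\sum_(l <- iota 1 k.+1) nodes (fun k => iota 1 k.+1) m l).
by rewrite sum_iota1; apply: eq_bigr => j _; rewrite IHm.
Qed.

(** The rule (p, q) -> (p+1, 0)^q (p, q+1)(p-1, q+2)...(1, q+p). *)
Definition two_label_succ (l : nat * nat) : seq (nat * nat) :=
  nseq l.2 (l.1.+1, 0) ++ [seq (l.1 - t, l.2 + t.+1) | t <- iota 0 l.1].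

Lemma ballotS_double m p :
  ballot m.+1 p.*2 = \sum_(s < p) (ballot m s.+1.*2 + ballot m s.+1.*2.+1).
Proof.
elim: p => [|p IHp]; first by rewrite /= !big_ord0.
by rewrite doubleS !ballotSS IHp big_ord_recr /= -addnA.
Qed.

Lemma sum_ord_rev_weight (p : nat) (F : nat -> nat) :
  \sum_(s < p) (p - s) * F s = \sum_(s < p) \sum_(u < s.+1) F u.
Proof.
elim: p => [|p IHp]; first by rewrite !big_ord0.
rewrite [RHS]big_ord_recr -IHp /= [X in _ + X]big_ord_recr big_ord_recr /=.
rewrite addnA -big_split subSnn mul1n; congr (_ + _).
by apply: eq_bigr => s _; rewrite subSn ?mulSn 1?addnC // ltnW.
Qed.

(** The formula comes from the generating function in the depth, which is
    1 + x (C^2 + C^4 + ... + C^(2p)) + q x C^(2p+1). At the root label (1, 0)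
    this is 1 + x C^2 = C, so this rule counts the same levels as the one-label
    rule although the two trees are not isomorphic. *)
Lemma nodes_two_label m p q :
  nodes two_label_succ m.+1 (p, q) =
    \sum_(s < p) ballot m s.+1.*2 + q * ballot m p.*2.+1.
Proof.
elim: m p q => [|m IHm] p q.
  rewrite /nodes sum1_size size_cat size_nseq size_map size_iota /=.
  by rewrite sum1_card card_ord muln1 addnC.
rewrite -[LHS]/(\sum_(l <- two_label_succ (p, q)) nodes two_label_succ m.+1 l).
rewrite big_cat big_nseq iter_addn_0 big_map -[p in iota 0 p]subn0.
rewrite -/(index_iota 0 p) big_mkord IHm mul0n addn0.
rewrite [X in _ + X = _](reindex_inj rev_ord_inj).
have children (s : 'I_p) : nodes two_label_succ m.+1
    (p - rev_ord s, q + (rev_ord s).+1) =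
    \sum_(u < s.+1) ballot m u.+1.*2 + (p - s) * ballot m s.+1.*2.+1
    + q * ballot m s.+1.*2.+1.
  have ltsp := ltn_ord s.
  rewrite IHm /= subKn // -subSn // subSS mulnDl.
  by rewrite addnAC addnA.
under eq_bigr do rewrite children.
rewrite !big_split (sum_ord_rev_weight p (fun s => ballot m s.+1.*2.+1)).
rewrite -big_distrr ballotSS ballotS_double [in LHS]big_ord_recr.
under [X in _ = X + _]eq_bigr do rewrite ballotS_double big_split.
by rewrite !big_split -doubleS /=; lia.
Qed.

(** * Permutations: inserting the maximum *)

Definition ins_max n (i : 'I_n.+1) (s : 'S_n) : 'S_n.+1 :=
  lift_perm i ord_max s.

Lemma ins_max_id n (i : 'I_n.+1) (s : 'S_n) : ins_max i s i = n :> nat.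
Proof. by rewrite /ins_max lift_perm_id. Qed.

Lemma ins_max_lift n (i : 'I_n.+1) (s : 'S_n) k :
  ins_max i s (lift i k) = s k :> nat.
Proof. by rewrite /ins_max lift_perm_lift lift_max. Qed.

Lemma lift_or_id n (i j : 'I_n.+1) : (exists k : 'I_n, j = lift i k) \/ j = i.
Proof. by case: (unliftP i j) => [k|] ->; [left; exists k | right]. Qed.

Lemma ins_max_bij n :
  bijective (fun u : 'I_n.+1 * 'S_n => ins_max u.1 u.2).
Proof.
apply: inj_card_bij => [[i s] [j t] /= eq_ij|]; last first.
  by rewrite card_prod card_ord !card_Sn factS.
have ij : i = j.
  apply: (@perm_inj _ (ins_max j t)); rewrite -{1}eq_ij.
  by rewrite /ins_max !lift_perm_id.
rewrite -{}ij in eq_ij *; congr (_, _); apply/permP=> k.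
apply: ord_inj; rewrite -(ins_max_lift i s) -(ins_max_lift i t).
by rewrite eq_ij.
Qed.

Local Notation catalan_perms n := (AV n [:: pat_1_23; pat_2_14_3]).

(** Both patterns speak of an ascent j, j+1 and an earlier entry a. Avoiding
    1-23 puts the value at a above the ascent bottom, and then avoiding 2-14-3
    only concerns the entries after the ascent. *)
Lemma catalan_permsP n (s : 'S_n) :
  reflect (forall a j j' : 'I_n, a < j -> j' = j.+1 :> nat -> s j < s j' ->
             s j < s a /\ forall c : 'I_n, j' < c -> ~~ (s a < s c < s j'))
          (s \in catalan_perms n).
Proof.
rewrite inE /= andbT; apply: (iffP andP) => [[no1 no2] a j j' aj jj' sjj'|sP].
  have sja : s j < s a.
    rewrite ltnNge; apply: contra no1 => saj; apply/contains_1_23P.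
    exists a, j, j'; split=> //; rewrite ltn_neqAle saj andbT.
    by apply: contraTneq aj => /val_inj/perm_inj->; rewrite ltnn.
  split=> // c j'c; apply: contra no2 => /andP[sac scj'].
  by apply/contains_2_14_3P; exists a, j, j', c.
split; apply/negP.
  case/contains_1_23P=> a [j [j' [aj jj' saj sjj']]].
  by have [sja _] := sP _ _ _ aj jj' sjj'; lia.
case/contains_2_14_3P=> a [j [j' [c [[aj jj' j'c] sja sac scj']]]].
have [|_ /(_ c j'c)] := sP _ _ _ aj jj'; first by lia.
by rewrite sac scj'.
Qed.

(** The starting positions of the skew-indecomposable components: every entry
    before [d] exceeds every entry from [d] on. Position 0 always qualifies, so
    for n > 0 the cardinal is the number of components. *)
Definition skew_splits n (s : 'S_n) : {set 'I_n} :=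
  [set d : 'I_n | [forall a : 'I_n, forall c : 'I_n,
                    (a < d <= c) ==> (s c < s a)]].

Lemma skew_splitsP n (s : 'S_n) (d : 'I_n) :
  reflect (forall a c : 'I_n, a < d -> d <= c -> s c < s a)
          (d \in skew_splits s).
Proof.
rewrite inE; apply: (iffP forallP) => [dP a c ad dc|dP a].
  by have /forallP/(_ c)/implyP-> := dP a; rewrite ?ad.
by apply/forallP=> c; apply/implyP=> /andP[]; apply: dP.
Qed.

(** A leading maximum is never followed by an ascent and is too large to play
    any other part. *)
Lemma ins_max0_AV n (s : 'S_n) :
  (ins_max ord0 s \in catalan_perms n.+1) = (s \in catalan_perms n).
Proof.
apply/catalan_permsP/catalan_permsP=> sP a j j' aj jj'.
  rewrite -!(ins_max_lift ord0 s) => sjj'.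
  have [||? cP] := sP (lift ord0 a) (lift ord0 j) (lift ord0 j') _ _ sjj'.
  - by rewrite !lift0.
  - by rewrite !lift0 jj'.
  split=> // c j'c; rewrite -(ins_max_lift ord0 s).
  by apply: cP; rewrite !lift0.
case: (lift_or_id ord0 j) aj jj' => [[j0 ->]|-> //].
case: (lift_or_id ord0 j') => [[j'0 ->]|-> //].
case: (lift_or_id ord0 a) => [[a0 ->]|->];
  rewrite !ins_max_lift !lift0 ?ins_max_id.
  move=> aj [jj'] sjj'; have [//|sja cP] := sP a0 j0 j'0 _ jj' sjj'.
  split=> // c; case: (lift_or_id ord0 c) => [[c0 ->]|-> //].
  by rewrite ins_max_lift lift0; apply: cP.
move=> _ _ _; split; first exact: ltn_ord.
by move=> c _; have := ltn_ord (ins_max ord0 s c); lia.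
Qed.

(** Inserting the maximum right after position [d] creates the ascent
    (s d, n). The two patterns forbid exactly that an entry before [d] be
    below s d, or below an entry after [d]; that is, [d] has to be a split. The
    ascent that the insertion may break up, at d and d+1, has the same bottom
    and a lower top, so it constrains [s] less than the new one. *)
Lemma ins_maxS_AV n (s : 'S_n) (d : 'I_n) :
  (ins_max (lift ord0 d) s \in catalan_perms n.+1) =
    (s \in catalan_perms n) && (d \in skew_splits s).
Proof.
set i := lift ord0 d; have iE : i = d.+1 :> nat by rewrite lift0.
move: i iE => i iE.
have lt_max (k : 'I_n) : s k < n by exact: ltn_ord.
apply/catalan_permsP/andP=> [sP|[/catalan_permsP sP /skew_splitsP dP]].
  have liftS (j : 'I_n) : lift i j = (d < j) + j :> nat by rewrite /= /bump iE.
  have beforeP (a k : 'I_n) : a < d -> d <= k -> s k < s a.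
    move=> ad dk.
    have [|||] := sP (lift i a) (lift i d) i.
    - by rewrite !liftS; lia.
    - by rewrite liftS; lia.
    - by rewrite ins_max_lift ins_max_id.
    rewrite !ins_max_lift ins_max_id => sda cP.
    have [-> //|kd] := eqVneq k d.
    have /cP : i < lift i k.
      by rewrite iE liftS; move: kd; rewrite -val_eqE /=; lia.
    rewrite ins_max_lift lt_max andbT -leqNgt leq_eqVlt => /orP[/eqP|//].
    by move/val_inj/perm_inj=> ka; move: dk; rewrite ka; lia.
  split; last by apply/skew_splitsP.
  apply/catalan_permsP=> a j j' aj jj' sjj'.
  (* The ascent at d, d+1 is the one that is not adjacent after insertion. *)
  have [jd|jd] := eqVneq j d.
    have saj (c : 'I_n) : d <= c -> s c < s a by apply: beforeP; rewrite -jd.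
    split=> [|c j'c]; first by apply: saj; rewrite jd.
    have /saj : d <= c by rewrite -jd; lia.
    by lia.
  have [||| sja cP] := sP (lift i a) (lift i j) (lift i j').
  - by rewrite !liftS; lia.
  - by rewrite !liftS; move: jd; rewrite -val_eqE /=; lia.
  - by rewrite !ins_max_lift.
  rewrite !ins_max_lift in sja; split=> // c j'c.
  have /cP : lift i j' < lift i c by rewrite !liftS; lia.
  by rewrite !ins_max_lift.
have liftS (j : 'I_n) : lift i j = (d < j) + j :> nat by rewrite /= /bump iE.
move=> a j j' aj jj' sjj'.
case: (lift_or_id i j) sjj' aj jj' => [[j0 ->]|->]; last first.
  by rewrite ins_max_id ltnNge -ltnS ltn_ord.
case: (lift_or_id i j') => [[j'0 ->]|->]; last first.
  rewrite ins_max_id ins_max_lift liftS iE => _.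
  case: (lift_or_id i a) => [[a0 ->]|->]; last by rewrite iE; lia.
  rewrite liftS ins_max_lift => aj jd.
  have sa (c : 'I_n) : d <= c -> s c < s a0 by apply: dP; lia.
  split=> [|c]; first by apply: sa; lia.
  case: (lift_or_id i c) => [[c0 ->]|->]; last by lia.
  by rewrite liftS ins_max_lift => dc; have /sa : d <= c0; lia.
rewrite !ins_max_lift !liftS => sjj' aj jj'.
case: (lift_or_id i a) aj => [[a0 ->]|->]; last first.
  rewrite ins_max_id => _; split=> // c _.
  by have := ltn_ord (ins_max i s c); lia.
rewrite !ins_max_lift !liftS => aj.
have [||sja cP] := sP a0 j0 j'0 _ _ sjj'; try lia.
split=> // c; case: (lift_or_id i c) => [[c0 ->]|->]; last first.
  by rewrite ins_max_id; have := lt_max j'0; lia.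
by rewrite liftS ins_max_lift => j'c; apply: cP; lia.
Qed.

(** The inserted maximum merges everything up to its position [i] into one
    component, so apart from 0 the new splits are the old ones at or after [i],
    moved one step to the right. *)
Lemma card_skew_splits_ins_max n (s : 'S_n) (i : 'I_n.+1) :
  #|skew_splits (ins_max i s)| = #|[set d in skew_splits s | i <= d]|.+1.
Proof.
suff -> : skew_splits (ins_max i s) =
    ord0 |: lift ord0 @: [set d in skew_splits s | i <= d].
  rewrite cardsU1 card_imset; last exact: lift_inj.
  suff -> : ord0 \notin lift ord0 @: [set d in skew_splits s | i <= d] by [].
  by apply/imsetP=> -[d _ /eqP]; rewrite (negPf (neq_lift _ _)).
have liftS (j : 'I_n) : lift i j = (i <= j) + j :> nat by [].
apply/setP=> d; rewrite in_setU1.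
case: (lift_or_id ord0 d) => [[x ->]|->]; last first.
  by rewrite eqxx; apply/skew_splitsP.
rewrite eq_sym (negPf (neq_lift _ _)) mem_imset /=; last exact: lift_inj.
rewrite [in RHS]inE.
apply/skew_splitsP/andP=> [xP|[/skew_splitsP xP ix]].
  have ix : i <= x.
    rewrite leqNgt; apply/negP=> xi.
    have := xP ord0 i; rewrite lift0 /= ins_max_id.
    by move=> /(_ isT xi); have := ltn_ord (ins_max i s ord0); lia.
  split=> //; apply/skew_splitsP=> a c ax xc.
  rewrite -!(ins_max_lift i s); apply: xP; rewrite lift0 liftS; lia.
move=> a c; rewrite lift0.
case: (lift_or_id i c) => [[c0 ->]|->]; last by lia.
case: (lift_or_id i a) => [[a0 ->]|->]; last first.
  by rewrite ins_max_id ins_max_lift ltn_ord.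
by rewrite !ins_max_lift !liftS => ax xc; apply: xP; lia.
Qed.

(** Counting the larger elements of A ranks the elements of A. This turns a sum
    over the splits into a sum over the labels of the children. *)
Lemma sum_card_above n (A : {set 'I_n}) (F : nat -> nat) :
  \sum_(d in A) F #|[set x in A | d < x]| = \sum_(j < #|A|) F j.
Proof.
elim: {A}_.+1 {-2}A (ltnSn #|A|) => // m IHm A.
have [->|[x0 Ax0]] := set_0Vmem A; first by rewrite cards0 big_set0 big_ord0.
case: (arg_minnP (P := fun x => x \in A) (fun x : 'I_n => x) Ax0)
  => y /= Ay ymin.
rewrite (cardsD1 y A) Ay add1n ltnS => /IHm IH.
rewrite big_ord_recr -IH (big_setD1 y) //= addnC; congr (_ + _).
  apply: eq_bigr => d /setD1P[dy Ad]; congr F; apply: eq_card => x.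
  rewrite !inE; case: eqP => [->|//]; rewrite ltnNge ymin //.
  by rewrite andbF.
congr F; apply: eq_card => x; rewrite !inE andbC.
have [Ax|] := boolP (x \in A); rewrite ?andbT ?andbF //.
by rewrite ltn_neqAle ymin // andbT eq_sym.
Qed.

(** Inserting at the front yields k+1 components, and inserting after the k
    splits in turn yields k, k-1, ..., 1 components. *)
Lemma catalan_perms_succ n (F : nat -> nat) :
  \sum_(t in catalan_perms n.+1) F #|skew_splits t| =
  \sum_(s in catalan_perms n) \sum_(k <- iota 1 #|skew_splits s|.+1) F k.
Proof.
under [RHS]eq_bigr do rewrite sum_iota1.
rewrite (reindex _ (onW_bij _ (ins_max_bij n))) /=.
rewrite -(pair_big_dep xpredT (fun i s => ins_max i s \in catalan_perms n.+1)
  (fun i s => F #|skew_splits (ins_max i s)|)) /=.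
rewrite (exchange_big_dep (mem (catalan_perms n))) /=; last first.
  move=> i s _; case: (lift_or_id ord0 i) => [[d ->]|->].
    by rewrite ins_maxS_AV => /andP[].
  by rewrite ins_max0_AV.
apply: eq_bigr => s sAV; rewrite big_mkcond big_ord_recl ins_max0_AV sAV.
under [X in _ + X = _]eq_bigr do rewrite ins_maxS_AV sAV.
rewrite -big_mkcond card_skew_splits_ins_max.
under [X in _ + X = _]eq_bigr do rewrite card_skew_splits_ins_max lift0.
rewrite (sum_card_above _ (fun k => F k.+1)).
rewrite [RHS]big_ord_recr /= addnC; congr (_ + F _.+1).
by apply: eq_card => d; rewrite !inE andbT.
Qed.

Lemma card_catalan_perms n : #|catalan_perms n| = ballot n 1.
Proof.
rewrite -nodes_one_label.
apply: (card_generating_tree (A := fun n => catalan_perms n)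
          (lab := fun n s => #|skew_splits s|)); last exact: catalan_perms_succ.
move=> F; have S0 (s : 'S_0) : s = 1%g by apply/permP=> -[].
rewrite (big_pred1 (1%g : 'S_0)) => [|s].
  by rewrite eq_card0 // => -[].
by rewrite [s]S0 /= eqxx; apply/catalan_permsP=> -[].
Qed.

(** * Inversion sequences: appending an entry *)

(** Entries read off at arbitrary natural numbers (0 out of range), to sidestep
    the dependent type of the entries. *)
Definition entry n (e : inversion_seq n) (k : nat) : nat :=
  oapp (fun i : 'I_n => nat_of_ord (e i)) 0 (insub k).

Lemma entryE n (e : inversion_seq n) (i : 'I_n) : entry e i = e i.
Proof. by rewrite /entry valK. Qed.

Definition extend n (e : inversion_seq n) (x : 'I_n.+1) : inversion_seq n.+1 :=
  [ffun i : 'I_n.+1 => inord (if i < n then entry e i else x) : 'I_i.+1].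

Lemma extend_widen n (e : inversion_seq n) (x : 'I_n.+1) (i : 'I_n) :
  extend e x (widen_ord (leqnSn n) i) = e i :> nat.
Proof. by rewrite ffunE /= ltn_ord entryE inordK. Qed.

Lemma extend_max n (e : inversion_seq n) (x : 'I_n.+1) :
  extend e x ord_max = x :> nat.
Proof. by rewrite ffunE /= ltnn inordK. Qed.

Lemma widen_or_max n (i : 'I_n.+1) :
  (exists j : 'I_n, i = widen_ord (leqnSn n) j) \/ i = ord_max.
Proof.
case: (unliftP ord_max i) => [j ->|->]; [left; exists j | by right].
by apply/ord_inj; rewrite lift_max.
Qed.

Lemma extend_bij n :
  bijective (fun u : inversion_seq n * 'I_n.+1 => extend u.1 u.2).
Proof.
pose restrict (e : inversion_seq n.+1) : inversion_seq n :=
  [ffun i : 'I_n => e (widen_ord (leqnSn n) i) : 'I_i.+1].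
exists (fun e => (restrict e, e ord_max : 'I_n.+1)) => [[e x]|e] /=.
  congr (_, _); last by apply/ord_inj; rewrite extend_max.
  by apply/ffunP=> i; apply/ord_inj; rewrite ffunE extend_widen.
apply/ffunP=> i; apply/ord_inj.
have [[j ->]|->] := widen_or_max i; last by rewrite extend_max.
by rewrite extend_widen ffunE.
Qed.

(** An entry is allowed a single later entry that does not exceed it; a
    saturated one has had it, so from then on all entries must exceed it. *)
Definition saturated n (e : inversion_seq n) : pred 'I_n :=
  fun i => [exists j : 'I_n, (i < j) && (e j <= e i)].

(** Shifted up by 1, so that 0 is the value for the empty sequence. *)
Definition top n (e : inversion_seq n) : nat := \max_(i < n) (e i).+1.

(** The least value that may be appended to [e]. *)
Definition sat n (e : inversion_seq n) : nat :=
  \max_(i < n | saturated e i) (e i).+1.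

Lemma sat_le_top n (e : inversion_seq n) : sat e <= top e.
Proof. by apply/bigmax_leqP=> i _; apply: leq_bigmax. Qed.

Lemma top_le n (e : inversion_seq n) : top e <= n.
Proof.
by apply/bigmax_leqP=> i _; apply: (leq_trans (ltn_ord (e i))); apply: ltn_ord.
Qed.

Lemma catalan_invP n (e : inversion_seq n) :
  reflect (forall i j k : 'I_n, i < j -> j < k -> e j <= e i -> e i < e k)
          (e \in catalan_inversion_seqs n).
Proof.
rewrite inE; apply: (iffP idP) => [eP i j k ij jk ji|eP].
  rewrite ltnNge; apply: contra eP => ki.
  apply/existsP; exists i; apply/existsP; exists j; apply/existsP; exists k.
  by apply/and5P.
apply/negP=> /existsP[i /existsP[j /existsP[k /and5P[ij jk ji _ ki]]]].
by have := eP i j k ij jk ji; move: ki; rewrite /= => ki; rewrite ltnNge ki.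
Qed.

Lemma extend_catalan n (e : inversion_seq n) (x : 'I_n.+1) :
  (extend e x \in catalan_inversion_seqs n.+1) =
    (e \in catalan_inversion_seqs n) && (sat e <= x).
Proof.
pose w := widen_ord (leqnSn n).
apply/catalan_invP/andP=> [eP|[/catalan_invP eP /bigmax_leqP satP] i j k].
  split; first apply/catalan_invP=> i j k.
    by have := eP (w i) (w j) (w k); rewrite !extend_widen.
  apply/bigmax_leqP=> i /existsP[j /andP[ij ji]].
  have := eP (w i) (w j) ord_max.
  by rewrite !extend_widen extend_max; apply=> //=.
have [[i0 ->]|->] := widen_or_max i; last first.
  by have := ltn_ord j; rewrite /= => *; lia.
have [[j0 ->]|->] := widen_or_max j; last first.
  by have := ltn_ord k; rewrite /= => *; lia.
have [[k0 ->]|->] := widen_or_max k;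
  rewrite !extend_widen ?extend_max => ij jk ji; first exact: eP ij jk ji.
by apply: satP; apply/existsP; exists j0; rewrite ji andbT.
Qed.

Lemma top_extend n (e : inversion_seq n) (x : 'I_n.+1) :
  top (extend e x) = maxn (top e) x.+1.
Proof.
rewrite /top big_ord_recr /= extend_max; congr maxn.
by apply: eq_bigr => i _; rewrite extend_widen.
Qed.

Lemma saturated_widen n (e : inversion_seq n) (x : 'I_n.+1) (i : 'I_n) :
  saturated (extend e x) (widen_ord (leqnSn n) i) = saturated e i || (x <= e i).
Proof.
apply/existsP/orP=> [[j]|[/existsP[j ij]|xi]].
- have [[k ->]|->] := widen_or_max j.
    by rewrite !extend_widen => ik; left; apply/existsP; exists k.
  by rewrite extend_widen extend_max => /andP[_]; right.
- by exists (widen_ord (leqnSn n) j); rewrite !extend_widen.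
by exists ord_max; rewrite extend_widen extend_max xi andbT /=.
Qed.

Lemma saturated_max n (e : inversion_seq n.+1) : saturated e ord_max = false.
Proof.
by apply/existsP=> -[j /andP[]]; have := ltn_ord j; rewrite /= => *; lia.
Qed.

(** Appending x saturates the entries that are at least x. If there are any, the
    largest entry is one of them; if not, the saturated ones do not change. *)
Lemma sat_extend n (e : inversion_seq n) (x : 'I_n.+1) :
  sat (extend e x) = if x < top e then top e else sat e.
Proof.
rewrite /sat big_mkcond big_ord_recr /= saturated_max maxn0 -big_mkcond /=.
under eq_bigl do rewrite saturated_widen.
under eq_bigr do rewrite extend_widen.
case: ltnP => [lt_x_top|le_top_x]; last first.
  apply: eq_bigl => i; rewrite leqNgt (leq_trans _ le_top_x) ?orbF //.
  exact: leq_bigmax.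
apply/eqP; rewrite eqn_leq; apply/andP; split.
  by apply/bigmax_leqP=> i _; apply: leq_bigmax.
have n_gt0 : 0 < #|'I_n| by rewrite card_ord; have := top_le e; lia.
have [i top_i] := eq_bigmax (fun i => (e i).+1) n_gt0.
rewrite [top e]top_i; apply: (leq_bigmax_cond (F := fun i => (e i).+1) i).
by rewrite -ltnS -top_i lt_x_top orbT.
Qed.

(** The admissible next values are those from [sat e] to n. The components count
    the ones above all entries of [e], and the others. *)
Definition inv_label n (e : inversion_seq n) : nat * nat :=
  (n.+1 - top e, top e - sat e).

(** A value below [top e] saturates the maximum, leaving only values above it:
    label (p+1, 0). The value top e + t becomes the new maximum without
    saturating anything: label (p-t, q+t+1). *)
Lemma catalan_inv_succ n (F : nat * nat -> nat) :
  \sum_(y in catalan_inversion_seqs n.+1) F (inv_label y) =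
  \sum_(e in catalan_inversion_seqs n)
     \sum_(l <- two_label_succ (inv_label e)) F l.
Proof.
rewrite (reindex _ (onW_bij _ (extend_bij n))) /=.
under eq_bigl do rewrite extend_catalan.
rewrite -(pair_big_dep (mem (catalan_inversion_seqs n))
  (fun e (x : 'I_n.+1) => sat e <= x)
  (fun e x => F (inv_label (extend e x)))) /=.
apply: eq_bigr => e _; have satT := sat_le_top e; have topn := top_le e.
rewrite /inv_label; under eq_bigr do rewrite top_extend sat_extend.
rewrite /two_label_succ big_cat big_nseq iter_addn_0 big_map /=.
rewrite -(big_geq_mkord (sat e) n.+1 xpredT
  (fun x => F (n.+2 - maxn (top e) x.+1,
               maxn (top e) x.+1 - (if x < top e then top e else sat e)))).
rewrite (big_cat_nat (n := top e)) //=; last by lia.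
congr (_ + _).
  under eq_big_nat => x /andP[_ xT].
    rewrite xT (maxn_idPl xT) subnn subSn ?(leq_trans topn) //; over.
  by rewrite sum_nat_const_nat mulnC.
rewrite -{1}[top e]add0n big_addn -[X in iota 0 X]subn0; apply: eq_bigr => t _.
have -> : maxn (top e) (t + top e).+1 = (t + top e).+1.
  by apply/maxn_idPr; lia.
have -> : (t + top e < top e) = false by lia.
by congr (F (_, _)); lia.
Qed.

Lemma card_catalan_inv n : #|catalan_inversion_seqs n| = ballot n 1.
Proof.
rewrite (card_generating_tree (A := catalan_inversion_seqs)
          (lab := inv_label) (root := (1, 0)) _ catalan_inv_succ).
  case: n => [//|n].
  by rewrite nodes_two_label mul0n addn0 big_ord1 /= big_ord1.
move=> F; pose e0 : inversion_seq 0 := [ffun i : 'I_0 => inord 0 : 'I_i.+1].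
rewrite (big_pred1 e0) => [|e].
  by rewrite /inv_label /top /sat !big_ord0.
have -> : e = e0 by apply/ffunP=> -[].
by rewrite /= eqxx; apply/catalan_invP=> -[].
Qed.

(** * The two families *)

Lemma eq_card_bijective (T U : finType) (A : {set T}) (B : {set U}) :
  #|A| = #|B| -> exists f : {x : T | x \in A} -> {y : U | y \in B}, bijective f.
Proof.
move=> eqAB.
have eqc : #|{: {x : T | x \in A}}| = #|{: {y : U | y \in B}}|.
  by rewrite !card_sig.
exists (fun x => enum_val (cast_ord eqc (enum_rank x))).
apply: bij_comp; first exact: enum_val_bij.
apply: bij_comp; last exact: enum_rank_bij.
by exists (cast_ord (esym eqc)); [apply: cast_ordK | apply: cast_ordKV].
Qed.

Theorem proposition5 (n : nat) (hn : (1 <= n)%N) :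
  (exists f : {e : inversion_seq n | e \in catalan_inversion_seqs n} ->
              {s : 'S_n | s \in AV n [:: pat_1_23; pat_2_14_3]},
     bijective f)
  /\
  (#|AV n [:: pat_1_23; pat_2_14_3]|%:R =
     1 / n.+1%:R * 'C(2 * n, n)%:R :> rat)%R.
Proof.
split.
  by apply: eq_card_bijective; rewrite card_catalan_perms card_catalan_inv.
rewrite card_catalan_perms -ballot1_catalan GRing.natrM GRing.mul1r.
by rewrite GRing.mulKf // Num.Theory.pnatr_eq0.
Qed.
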